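(* The Grothendieck ring $\mathrm{Gr}^{\mathrm{bi}}(\mathfrak{L})$ of a left Leibniz algebra $\mathfrak{L}$ over a field $\mathbb{F}$ is commutative. Moreover, the class $[F_0^{s/a}]$ of the one-dimensional trivial $\mathfrak{L}$-bimodule $F_0^{s/a}$ is the unity of $\mathrm{Gr}^{\mathrm{bi}}(\mathfrak{L})$.
   Context: Rings are not assumed associative. A left Leibniz algebra is an $\mathbb{F}$-vector space $\mathfrak{L}$ with a bilinear multiplication satisfying $x(yz)=(xy)z+y(xz)$. An $\mathfrak{L}$-bimodule is an $\mathbb{F}$-vector space $M$ with bilinear left and right $\mathfrak{L}$-actions satisfying, for all $x,y\in\mathfrak{L}$, $m\in M$: (LLM) $(xy)\cdot m=x\cdot(y\cdot m)-y\cdot(x\cdot m)$; (LML) $(x\cdot m)\cdot y=x\cdot(m\cdot y)-m\cdot(xy)$; (MLL) $(m\cdot x)\cdot y=m\cdot(xy)-x\cdot(m\cdot y)$. $F_0^{s/a}$ is the ground field $\mathbb{F}$ with zero left and right actions. For $\mathfrak{L}$-bimodules $M,N$, the space $M\otimes N$ (over $\mathbb{F}$) carries the actions $x\cdot(m\otimes n):=(x\cdot m)\otimes n+m\otimes(x\cdot n)$ and $(m\otimes n)\cdot x:=(m\cdot x)\otimes n+m\otimes(n\cdot x)$. Let $T(M,N)$ be the smallest subspace of $M\otimes N$ closed under both actions and containing all elements $(x\cdot m+m\cdot x)\otimes(n\cdot y)+(m\cdot y)\otimes(x\cdot n+n\cdot x)$ with $x,y\in\mathfrak{L}$, $m\in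 M$, $n\in N$. The truncated tensor product $M\,\overline{\otimes}\,N:=(M\otimes N)/T(M,N)$ is an $\mathfrak{L}$-bimodule. $\mathrm{Gr}^{\mathrm{bi}}(\mathfrak{L})$ is the free abelian group on the set $\mathrm{Irr}^{\mathrm{bi}}(\mathfrak{L})$ of isomorphism classes of finite-dimensional irreducible $\mathfrak{L}$-bimodules; each finite-dimensional $\mathfrak{L}$-bimodule $X$ has a class $[X]:=\sum_{[L]\in\mathrm{Irr}^{\mathrm{bi}}(\mathfrak{L})}[X:L][L]$, where $[X:L]$ is the multiplicity of $L$ in a composition series of $X$. Its multiplication is the biadditive extension of $[M]\cdot[N]:=[M\,\overline{\otimes}\,N]$ for $[M],[N]\in\mathrm{Irr}^{\mathrm{bi}}(\mathfrak{L})$. *)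

(* Defs.v *)
From HB Require Import structures.
From mathcomp Require Import all_boot all_order all_algebra.
From mathcomp Require Import boolp classical_sets fsbigop.
From mathcomp Require Import ring.
From mathcomp Require Import freeg.

Set Implicit Arguments.
Unset Strict Implicit.
Unset Printing Implicit Defensive.

Import GRing.Theory.
Local Open Scope classical_set_scope.
Local Open Scope ring_scope.

Definition mk_bilinear (F : fieldType) (U V W : lmodType F) (f : U -> V -> W)
    (f_bilin : bilinear_for *:%R *:%R f) : {bilinear U -> V -> W} :=
  HB.pack f (bilinear_isBilinear.Build F U V W *:%R *:%R f f_bilin).

Record leibnizAlgebra (F : fieldType) := LeibnizAlgebra {
  leib_space :> lmodType F;
  leib_mul : {bilinear leib_space -> leib_space -> leib_space};
  leib_id : forall x y z, leib_mul x (leib_mul y z) =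
    leib_mul (leib_mul x y) z + leib_mul y (leib_mul x z)
}.

(* A finite-dimensional space with arbitrary bilinear left and right actions:
   the untruncated tensor product of two bimodules is in general only that. *)
Record biaction (F : fieldType) (L : leibnizAlgebra F) := Biaction {
  biact_space :> vectType F;
  lact : {bilinear L -> biact_space -> biact_space};
  ract : {bilinear biact_space -> L -> biact_space}
}.

Notation "x '*>' m" := (lact _ x m) (at level 40, left associativity).
Notation "m '<*' x" := (ract _ m x) (at level 40, left associativity).

Record is_bimodule (F : fieldType) (L : leibnizAlgebra F) (M : biaction L) :
    Prop := IsBimodule {
  LLM : forall (x y : L) (m : M),
    leib_mul L x y *> m = x *> (y *> m) - y *> (x *> m);
  LML : forall (x y : L) (m : M),
    (x *> m) <* y = x *> (m <* y) - m <* leib_mul L x y;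
  MLL : forall (x y : L) (m : M),
    (m <* x) <* y = m <* leib_mul L x y - x *> (m <* y)
}.

(* All bimodules below are finite-dimensional. *)
Record bimodule (F : fieldType) (L : leibnizAlgebra F) := Bimodule {
  bimod_biact :> biaction L;
  bimodP : is_bimodule bimod_biact
}.

Definition bimod_iso (F : fieldType) (L : leibnizAlgebra F)
    (M N : bimodule L) : Prop :=
  exists f : {linear M -> N}, [/\ bijective f,
    forall (x : L) (m : M), f (x *> m) = x *> f m
    & forall (x : L) (m : M), f (m <* x) = f m <* x].

Record stableSpace (F : fieldType) (L : leibnizAlgebra F) (M : biaction L) :=
  StableSpace {
  stable_space :> {vspace M};
  stableP : forall (x : L) (m : M), m \in stable_space ->
    x *> m \in stable_space /\ m <* x \in stable_space
}.

Definition irreducible (F : fieldType) (L : leibnizAlgebra F)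
    (M : bimodule L) : Prop :=
  ({:M} != 0)%VS /\
  forall U : stableSpace M, U = 0%VS :> {vspace M} \/ U = fullv :> {vspace M}.

Section Trivial.
Variables (F : fieldType) (L : leibnizAlgebra F).

Fact zero_is_bilinear (U V W : lmodType F) :
  bilinear_for *:%R *:%R (fun (_ : U) (_ : V) => 0 : W).
Proof. by split=> ? ? ? ?; rewrite addr0; apply/esym/scaler0. Qed.

Definition triv_biact : biaction L :=
  @Biaction F L F^o (mk_bilinear (@zero_is_bilinear L F^o F^o))
    (mk_bilinear (@zero_is_bilinear F^o L F^o)).

Fact triv_is_bimodule : is_bimodule triv_biact.
Proof. by split=> x y m /=; rewrite subrr. Qed.

Definition triv_bimod : bimodule L := Bimodule triv_is_bimodule.

End Trivial.

Section Sub.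
Variables (F : fieldType) (L : leibnizAlgebra F) (M : biaction L).
Variable U : stableSpace M.

Definition sub_lact (x : L) (u : subvs_of U) : subvs_of U :=
  Subvs (stableP x (subvsP u)).1.
Definition sub_ract (u : subvs_of U) (x : L) : subvs_of U :=
  Subvs (stableP x (subvsP u)).2.

Fact sub_lact_is_bilinear : bilinear_for *:%R *:%R sub_lact.
Proof.
by split=> [u|x] a y z; apply: val_inj; rewrite /= ?linearPl ?linearPr.
Qed.
Fact sub_ract_is_bilinear : bilinear_for *:%R *:%R sub_ract.
Proof.
by split=> [u|x] a y z; apply: val_inj; rewrite /= ?linearPl ?linearPr.
Qed.

Definition sub_biact : biaction L :=
  @Biaction F L (subvs_of U) (mk_bilinear sub_lact_is_bilinear)
    (mk_bilinear sub_ract_is_bilinear).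

End Sub.

Fact sub_is_bimodule (F : fieldType) (L : leibnizAlgebra F) (M : bimodule L)
  (U : stableSpace M) : is_bimodule (sub_biact U).
Proof.
by split=> x y m; apply: val_inj; rewrite /= ?(LLM (bimodP M))
  ?(LML (bimodP M)) ?(MLL (bimodP M)).
Qed.

Definition sub_bimod (F : fieldType) (L : leibnizAlgebra F) (M : bimodule L)
  (U : stableSpace M) : bimodule L := Bimodule (sub_is_bimodule U).

(* M / U is carried by the complement U^C, the canonical projection M -> M / U
   being the projection onto U^C along U. *)
Section Quotient.
Variables (F : fieldType) (L : leibnizAlgebra F) (M : biaction L).
Variable U : stableSpace M.
Let Q := subvs_of (U^C)%VS.

Definition quot_proj (m : M) : Q := vsproj (U^C)%VS (daddv_pi (U^C)%VS U m).

Fact quot_proj_is_linear : linear quot_proj.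
Proof. by move=> a m n; rewrite /quot_proj !linearP. Qed.
HB.instance Definition _ :=
  GRing.isLinear.Build F M Q *:%R quot_proj quot_proj_is_linear.

Lemma quot_projK (q : Q) : quot_proj (vsval q) = q.
Proof.
rewrite /quot_proj daddv_pi_id ?subvsP ?vsvalK //.
by rewrite capvC capv_compl.
Qed.

Lemma quot_proj_eq0 (m : M) : (quot_proj m == 0) = (m \in (U : {vspace M})).
Proof.
have dx : ((U^C)%VS :&: U = 0)%VS by rewrite capvC capv_compl.
have mE : daddv_pi (U^C)%VS U m + daddv_pi U (U^C)%VS m = m.
  by rewrite daddv_pi_add // addvC addv_complf memvf.
apply/eqP/idP => [/(congr1 vsval)|mU].
  rewrite /quot_proj vsprojK ?memv_pi // => m0.
  by rewrite -mE m0 add0r memv_pi.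
apply: val_inj; rewrite /= /quot_proj vsprojK ?memv_pi //.
move: mE; rewrite (daddv_pi_id (V := (U^C)%VS) _ mU) ?capv_compl //.
by move/(canRL (addrK _)); rewrite subrr.
Qed.

Definition quot_lact (x : L) (q : Q) : Q := quot_proj (x *> vsval q).
Definition quot_ract (q : Q) (x : L) : Q := quot_proj (vsval q <* x).

Fact quot_lact_is_bilinear : bilinear_for *:%R *:%R quot_lact.
Proof.
by split=> [u|x] a y z; rewrite /quot_lact ?linearPl ?linearP ?linearPr ?linearP.
Qed.
Fact quot_ract_is_bilinear : bilinear_for *:%R *:%R quot_ract.
Proof.
by split=> [u|x] a y z; rewrite /quot_ract ?linearPl ?linearP ?linearPl ?linearPr ?linearP.
Qed.

Definition quot_biact : biaction L :=
  @Biaction F L Q (mk_bilinear quot_lact_is_bilinear)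
    (mk_bilinear quot_ract_is_bilinear).

Lemma quot_projP (m n : M) :
  quot_proj m = quot_proj n <-> m - n \in (U : {vspace M}).
Proof.
rewrite -quot_proj_eq0 linearB subr_eq0.
by split=> /eqP.
Qed.

Lemma quot_proj_lact (x : L) (m : M) :
  quot_proj (x *> m) = x *> (quot_proj m : quot_biact).
Proof.
apply/quot_projP; rewrite -linearBr.
by apply: (stableP x _).1; apply/quot_projP; rewrite quot_projK.
Qed.

Lemma quot_proj_ract (x : L) (m : M) :
  quot_proj (m <* x) = (quot_proj m : quot_biact) <* x.
Proof.
apply/quot_projP; rewrite -linearBl.
by apply: (stableP x _).2; apply/quot_projP; rewrite quot_projK.
Qed.

End Quotient.

Fact quot_is_bimodule (F : fieldType) (L : leibnizAlgebra F) (M : bimodule L)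
  (U : stableSpace M) : is_bimodule (quot_biact U).
Proof.
split=> x y m; rewrite -(quot_projK m) -!(quot_proj_lact, quot_proj_ract).
- by rewrite (LLM (bimodP M)) linearB.
- by rewrite (LML (bimodP M)) linearB.
- by rewrite (MLL (bimodP M)) linearB.
Qed.

Definition quot_bimod (F : fieldType) (L : leibnizAlgebra F) (M : bimodule L)
  (U : stableSpace M) : bimodule L := Bimodule (quot_is_bimodule U).

(* M (x) N is realized as a space of matrices: with (e_i) and (f_j) the bases
   of M and N fixed by the library, A stands for sum_ij A_ij e_i (x) f_j.  The
   lemmas tens_lift_tens and tens_ext are its universal property. *)
Section TensorSpace.
Variables (F : fieldType) (M N : vectType F).

Definition tens_space : vectType F := 'M[F]_(\dim {:M}, \dim {:N}).

Definition tens (m : M) (n : N) : tens_space :=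
  \matrix_(i, j) (coord (vbasis {:M}) i m * coord (vbasis {:N}) j n).

Fact tens_is_bilinear : bilinear_for *:%R *:%R tens.
Proof.
split=> [n|m] a u v; apply/matrixP=> i j; rewrite !mxE linearP /=.
  by rewrite mulrDl mulrA.
by rewrite mulrDr mulrCA.
Qed.
HB.instance Definition _ :=
  bilinear_isBilinear.Build F M N tens_space *:%R *:%R tens tens_is_bilinear.

Definition tens_lift (W : lmodType F) (f : M -> N -> W) (t : tens_space) : W :=
  \sum_i \sum_j t i j *: f (vbasis {:M})`_i (vbasis {:N})`_j.

Fact tens_lift_is_linear (W : lmodType F) (f : M -> N -> W) :
  linear (tens_lift f).
Proof.
move=> a s t; rewrite /tens_lift scaler_sumr -big_split /=.
apply: eq_bigr => i _; rewrite scaler_sumr -big_split /=.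
by apply: eq_bigr => j _; rewrite !mxE scalerDl scalerA.
Qed.
HB.instance Definition _ (W : lmodType F) (f : M -> N -> W) :=
  GRing.isLinear.Build F tens_space W *:%R (tens_lift f)
    (tens_lift_is_linear f).

Lemma tens_lift_tens (W : lmodType F) (f : M -> N -> W) (m : M) (n : N) :
  bilinear_for *:%R *:%R f -> tens_lift f (tens m n) = f m n.
Proof.
move=> f_bilin; set g := mk_bilinear f_bilin.
have -> : f m n = g m n by [].
rewrite [in RHS](coord_vbasis (memvf m)) [in RHS](coord_vbasis (memvf n)).
rewrite linear_sumlz; apply: eq_bigr => i _.
rewrite linearZl_LR linear_sumr scaler_sumr; apply: eq_bigr => j _.
by rewrite !mxE linearZr_LR scalerA.
Qed.

Lemma tens_ext (W : lmodType F) (f g : {linear tens_space -> W}) :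
  (forall m n, f (tens m n) = g (tens m n)) -> f =1 g.
Proof.
move=> eq_fg t.
have -> : t = \sum_i \sum_j t i j *:
    tens (vbasis {:M})`_i (vbasis {:N})`_j :> tens_space.
  rewrite [LHS]matrix_sum_delta; apply: eq_bigr => i _; apply: eq_bigr => j _.
  congr (_ *: _); apply/matrixP=> i' j'; rewrite !mxE.
  rewrite !coord_free ?(basis_free (vbasisP _)) //.
  by rewrite -natrM mulnb (eq_sym i) (eq_sym j).
rewrite !linear_sum; apply: eq_bigr => i _; rewrite !linear_sum.
by apply: eq_bigr => j _; rewrite !linearZ /= eq_fg.
Qed.

End TensorSpace.

Section Tensor.
Variables (F : fieldType) (L : leibnizAlgebra F) (M N : biaction L).

Definition tens_lact (x : L) : tens_space M N -> tens_space M N :=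
  tens_lift (fun m n => tens (x *> m) n + tens m (x *> n)).
Definition tens_ract (t : tens_space M N) (x : L) : tens_space M N :=
  tens_lift (fun m n => tens (m <* x) n + tens m (n <* x)) t.

Lemma tens_lactE (x : L) (m : M) (n : N) :
  tens_lact x (tens m n) = tens (x *> m) n + tens m (x *> n).
Proof.
rewrite /tens_lact tens_lift_tens //; split=> [v|u] a y z.
  by rewrite !(linearPl, linearPr) /= scalerDr addrACA.
by rewrite !(linearPl, linearPr) /= scalerDr addrACA.
Qed.

Lemma tens_ractE (x : L) (m : M) (n : N) :
  tens_ract (tens m n) x = tens (m <* x) n + tens m (n <* x).
Proof.
rewrite /tens_ract tens_lift_tens //; split=> [v|u] a y z.
  by rewrite !(linearPl, linearPr) /= scalerDr addrACA.
by rewrite !(linearPl, linearPr) /= scalerDr addrACA.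
Qed.

Fact tens_lact_is_bilinear : bilinear_for *:%R *:%R tens_lact.
Proof.
split=> [t|x] a y z; last exact: linearP.
rewrite /tens_lact /tens_lift /= scaler_sumr -big_split /=.
apply: eq_bigr => i _; rewrite scaler_sumr -big_split /=.
apply: eq_bigr => j _; rewrite scalerA [a * _]mulrC -scalerA -scalerDr.
by congr (_ *: _); rewrite !(linearPl, linearPr) /= scalerDr addrACA.
Qed.

Fact tens_ract_is_bilinear : bilinear_for *:%R *:%R tens_ract.
Proof.
split=> [x|t] a y z; first exact: linearP.
rewrite /tens_ract /tens_lift /= scaler_sumr -big_split /=.
apply: eq_bigr => i _; rewrite scaler_sumr -big_split /=.
apply: eq_bigr => j _; rewrite scalerA [a * _]mulrC -scalerA -scalerDr.
by congr (_ *: _); rewrite !(linearPl, linearPr) /= scalerDr addrACA.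
Qed.

Definition tens_biact : biaction L :=
  @Biaction F L (tens_space M N) (mk_bilinear tens_lact_is_bilinear)
    (mk_bilinear tens_ract_is_bilinear).

Definition trunc_gens : set tens_biact :=
  [set t | exists (x y : L) (m : M) (n : N),
    t = tens (x *> m + m <* x) (n <* y) + tens (m <* y) (x *> n + n <* x)].

Definition is_truncation (U : stableSpace tens_biact) : Prop :=
  (forall t, trunc_gens t -> t \in (U : {vspace _})) /\
  forall V : stableSpace tens_biact,
    (forall t, trunc_gens t -> t \in (V : {vspace _})) -> (U <= V)%VS.

Lemma ex_truncation : exists U, is_truncation U.
Proof.
pose P n := `[< exists2 U : stableSpace tens_biact,
  (forall t, trunc_gens t -> t \in (U : {vspace _})) & \dim U = n >].
have exP : exists n, P n.
  exists (\dim {:tens_biact}); apply/asboolP.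
  suff stT : forall (x : L) (m : tens_biact), m \in fullv ->
      x *> m \in fullv /\ m <* x \in fullv.
    by exists (StableSpace stT) => // t _; rewrite memvf.
  by move=> x m _; rewrite !memvf.
case: (ex_minnP exP) => n /asboolP[U genU dimU] minU; exists U; split=> // V genV.
have stUV (x : L) (m : tens_biact) : m \in (U :&: V)%VS ->
    x *> m \in (U :&: V)%VS /\ m <* x \in (U :&: V)%VS.
  rewrite !memv_cap => /andP[/(stableP x)[-> ->] /(stableP x)[-> ->]] //.
have /minU : P (\dim (U :&: V)%VS).
  apply/asboolP; exists (StableSpace stUV) => // t tP.
  by rewrite memv_cap genU // genV.
rewrite -dimU => leU; apply/capv_idPl/eqP.
by rewrite eqEdim capvSl leU.
Qed.

Definition truncation : stableSpace tens_biact := projT1 (cid ex_truncation).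

Lemma truncationP : is_truncation truncation.
Proof. by rewrite /truncation; case: cid. Qed.

Definition trunc_biact : biaction L := quot_biact truncation.

End Tensor.

Fact trunc_is_bimodule (F : fieldType) (L : leibnizAlgebra F)
  (M N : bimodule L) : is_bimodule (trunc_biact M N).
Proof.
pose T := truncation M N; pose B := tens_biact M N.
pose l x : {linear B -> B} := lact B x.
pose r x : {linear B -> B} := applyr (ract B) x.
pose p : {linear B -> quot_biact T} := quot_proj T.
have lD x : {morph tens_lact x : s t / s + t >-> (s + t : tens_space M N)}.
  exact: linearD.
have rD x : {morph (@tens_ract _ _ M N)^~ x : s t / s + t}.
  exact: linearD.
have pl x (t : B) : x *> p t = p (l x t) by rewrite [RHS]quot_proj_lact.
have pr x (t : B) : p t <* x = p (r x t) by rewrite [RHS]quot_proj_ract.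
have p_onto (q : trunc_biact M N) : {t | q = p t}.
  by exists (vsval q); rewrite [RHS]quot_projK.
split=> x y q; have [t {q}->] := p_onto q.
- rewrite !(pl _ t) (pl _ (l y t)) (pl _ (l x t)) -linearB.
  apply: (tens_ext (f := p \o l (leib_mul L x y))
    (g := p \o ((l x \o l y) \- (l y \o l x)))) => m n /=.
  congr (p _); rewrite !tens_lactE !lD !tens_lactE.
  rewrite !(LLM (bimodP _)) linearBl linearBr /=.
  by apply/matrixP=> i j; rewrite !mxE; ring.
- rewrite (pl _ t) !(pr _ t) (pr _ (l x t)) (pl _ (r y t)) -linearB.
  apply: (tens_ext (f := p \o (r y \o l x))
    (g := p \o ((l x \o r y) \- r (leib_mul L x y)))) => m n /=.
  congr (p _); rewrite /applyr /= !(tens_lactE, tens_ractE) lD rD.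
  rewrite !(tens_lactE, tens_ractE).
  rewrite !(LML (bimodP _)) linearBl linearBr /=.
  by apply/matrixP=> i j; rewrite !mxE; ring.
rewrite !(pr _ t) (pr _ (r x t)) (pl _ (r y t)) -linearB.
apply: (tens_ext (f := p \o (r y \o r x))
    (g := p \o (r (leib_mul L x y) \- (l x \o r y)))) => m n /=.
rewrite /applyr /= !(tens_lactE, tens_ractE) lD rD !(tens_lactE, tens_ractE).
rewrite !(MLL (bimodP _)) linearBl linearBr /=.
apply/(@quot_projP _ _ B T); have [genT _] := truncationP M N.
rewrite (_ : _ - _ = tens (x *> m + m <* x) (n <* y)
    + tens (m <* y) (x *> n + n <* x)); first by apply: genT; exists x, y, m, n.
by rewrite linearDl linearDr /=; apply/matrixP=> i j; rewrite !mxE; ring.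
Qed.

Definition trunc_tensor (F : fieldType) (L : leibnizAlgebra F)
  (M N : bimodule L) : bimodule L := Bimodule (trunc_is_bimodule M N).

Section CompositionSeries.
Variables (F : fieldType) (L : leibnizAlgebra F) (X : bimodule L).

Fact stable0_subproof (x : L) (m : X) :
  m \in 0%VS -> x *> m \in 0%VS /\ m <* x \in 0%VS.
Proof. by rewrite memv0 => /eqP->; rewrite linear0r linear0l !mem0v. Qed.

Definition stable0 : stableSpace X := StableSpace stable0_subproof.

Fact stable_in_subproof (W U : stableSpace X) (x : L) (u : sub_bimod U) :
  u \in (linfun vsval @^-1: W)%VS ->
  x *> u \in (linfun vsval @^-1: W)%VS /\ u <* x \in (linfun vsval @^-1: W)%VS.
Proof.
by rewrite -!memv_preim !lfunE => /(stableP x).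
Qed.

Definition stable_in (W U : stableSpace X) : stableSpace (sub_bimod U) :=
  StableSpace (@stable_in_subproof W U).

Definition subquotient (W U : stableSpace X) : bimodule L :=
  quot_bimod (stable_in W U).

Definition composition_series (s : seq (stableSpace X)) : Prop :=
  path (fun W U : stableSpace X => (W <= U)%VS && `[< irreducible (subquotient W U) >])
    stable0 s /\
  last stable0 s = fullv :> {vspace X}.

Lemma ex_irreducible_subquotient (W : stableSpace X) :
  W <> fullv :> {vspace X} ->
  exists U : stableSpace X,
    [/\ (W <= U)%VS, (\dim W < \dim U)%N & irreducible (subquotient W U)].
Proof.
move=> W_neqT.
pose P n := `[< exists U : stableSpace X,
  [/\ (W <= U)%VS, (\dim W < \dim U)%N & \dim U = n] >].
have exP : exists n, P n.
  exists (\dim {:X}); apply/asboolP.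
  have stT (x : L) (m : X) : m \in fullv -> x *> m \in fullv /\ m <* x \in fullv.
    by rewrite !memvf.
  exists (StableSpace stT); split=> //=; first exact: subvf.
  by rewrite ltnNge; apply/negP => leTW; apply: W_neqT; apply/eqP;
     rewrite eqEdim subvf.
case: (ex_minnP exP) => _ /asboolP[U [leWU ltWU <-]] minU.
exists U; split=> //; set R := stable_in W U; pose p : {linear sub_bimod U -> subquotient W U} := quot_proj R.
have memR (u : sub_bimod U) : (u \in (R : {vspace _})) = (vsval u \in (W : {vspace _})).
  by rewrite -memv_preim lfunE.
split.
  apply/negP => /eqP Q0; move: ltWU; rewrite ltnNge; apply/negP; rewrite negbK.
  apply/dimvS/subvP => m mU; rewrite -[m](vsprojK mU) -memR -quot_proj_eq0.
  by rewrite -memv0 -Q0 memvf.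
move=> V.
pose Vp : {vspace X} :=
  (linfun (@vsval _ _ U) @: (linfun p @^-1: V))%VS.
have VpP (u : sub_bimod U) : (vsval u \in Vp) = (p u \in (V : {vspace _})).
  apply/memv_imgP/idP => [[v]|pu].
    by rewrite -memv_preim !lfunE => pv /= /subvs_inj ->.
  by exists u; rewrite ?lfunE // -memv_preim lfunE.
have VpU m : m \in Vp -> m \in (U : {vspace _}).
  by case/memv_imgP=> v _ ->; rewrite lfunE subvsP.
have stV (x : L) (m : X) : m \in Vp -> x *> m \in Vp /\ m <* x \in Vp.
  move=> mV; have mU := VpU _ mV; move: mV; rewrite -[m](vsprojK mU).
  move: (vsproj _ _) => u {m mU}; rewrite VpP => /(stableP x)[].
  rewrite -quot_proj_lact -quot_proj_ract => lu ru.
  by split; [rewrite -[_ *> _]/(vsval (x *> (u : sub_bimod U)))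
            | rewrite -[_ <* _]/(vsval ((u : sub_bimod U) <* x))]; rewrite VpP.
have leWV : (W <= Vp)%VS.
  apply/subvP => m mW; have mU := subvP leWU _ mW; move: mW.
  rewrite -[m](vsprojK mU) -memR VpP -quot_proj_eq0 => /eqP p0.
  by have -> : p (vsproj U m) = 0 by []; rewrite mem0v.
case: (leqP (\dim Vp) (\dim W)) => dimV; [left|right].
  have VpW : (Vp = W)%VS by apply/eqP; rewrite eq_sym eqEdim leWV.
  apply/eqP; rewrite -subv0; apply/subvP => q; rewrite -(quot_projK q).
  by rewrite -VpP VpW -memR -quot_proj_eq0 memv0.
have /minU leUV : P (\dim Vp).
  by apply/asboolP; exists (StableSpace stV); split.
have VpE : (Vp = U)%VS.
  by apply/eqP; rewrite eqEdim leUV andbT; apply/subvP.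
apply/eqP; rewrite eqEsubv subvf; apply/subvP => q _; rewrite -(quot_projK q).
by rewrite -VpP VpE subvsP.
Qed.

Lemma ex_composition_series : exists s, composition_series s.
Proof.
suff from (W : stableSpace X) : exists s : seq (stableSpace X),
    path (fun W U : stableSpace X =>
      (W <= U)%VS && `[< irreducible (subquotient W U) >]) W s /\
    last W s = fullv :> {vspace X}.
  exact: from.
have [n] := ubnP (\dim {:X} - \dim W); elim: n W => // n IHn W leWn.
have [WT|/eqP WT] := eqVneq (W : {vspace X}) fullv; first by exists [::].
have [U [leWU ltWU irrWU]] := ex_irreducible_subquotient WT.
have [|s [pUs lUs]] := IHn U.
  rewrite -ltnS; apply: leq_trans leWn; rewrite !ltnS ltn_sub2l //.
  by rewrite (leq_trans ltWU) ?dimvS ?subvf.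
by exists (U :: s); split=> //=; rewrite leWU pUs andbT; apply/asboolP.
Qed.

Definition the_comp_series : seq (stableSpace X) :=
  projT1 (cid ex_composition_series).

Definition comp_factors : seq (bimodule L) :=
  pairmap subquotient stable0 the_comp_series.

End CompositionSeries.

Lemma bimod_iso_refl (F : fieldType) (L : leibnizAlgebra F) (M : bimodule L) :
  bimod_iso M M.
Proof. by exists idfun; split=> //; exists id. Qed.

Lemma bimod_iso_sym (F : fieldType) (L : leibnizAlgebra F) (M N : bimodule L) :
  bimod_iso M N -> bimod_iso N M.
Proof.
case=> f [[g fK gK] fl fr].
have g_lin : linear g by exact: can2_linear fK gK.
pose g' : {linear N -> M} := HB.pack g (GRing.isLinear.Build F N M *:%R g g_lin).
exists g'; split=> [|x n|x n]; first by exists f.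
  by apply: (can_inj fK); rewrite fl /= !gK.
by apply: (can_inj fK); rewrite fr /= !gK.
Qed.

Lemma bimod_iso_trans (F : fieldType) (L : leibnizAlgebra F)
    (M N P : bimodule L) : bimod_iso M N -> bimod_iso N P -> bimod_iso M P.
Proof.
case=> f [f_bij fl fr] [g [g_bij gl gr]]; exists (g \o f).
by split=> [|x m|x m]; [exact: bij_comp | rewrite /= fl gl | rewrite /= fr gr].
Qed.

Lemma irreducible_iso (F : fieldType) (L : leibnizAlgebra F)
    (M N : bimodule L) : bimod_iso M N -> irreducible M -> irreducible N.
Proof.
case=> f [[g fK gK] fl fr] [M0 irrM].
have imK (U : {vspace N}) : (linfun f @: (linfun f @^-1: U))%VS = U.
  apply/vspaceP => n; apply/memv_imgP/idP => [[m]|nU].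
    by rewrite -memv_preim => mU ->.
  by exists (g n); rewrite -?memv_preim lfunE /= gK.
split.
  apply: contra_neq M0 => N0; apply/eqP; rewrite -subv0; apply/subvP => m _.
  have : f m \in {:N}%VS by rewrite memvf.
  by rewrite N0 !memv0 -(inj_eq (can_inj fK)) linear0.
move=> U; have stU (x : L) (m : M) : m \in (linfun f @^-1: U)%VS ->
    x *> m \in (linfun f @^-1: U)%VS /\ m <* x \in (linfun f @^-1: U)%VS.
  by rewrite -!memv_preim !lfunE /= fl fr => /(stableP x).
rewrite -(imK U); case: (irrM (StableSpace stU)) => /= ->.
  by left; rewrite limg0.
right; apply/vspaceP => n; rewrite memvf; apply/memv_imgP.
by exists (g n); rewrite ?memvf // lfunE /= gK.
Qed.

(* The bimodules carried by some 'rV[F]_n; up to isomorphism they are all the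
   bimodules (iso_coord_bimod).  They form a type small enough to index a free
   abelian group, whereas bimodule L quantifies over all vector spaces. *)
Record coord_bimod (F : fieldType) (L : leibnizAlgebra F) := CoordBimod {
  coord_dim : nat;
  coord_lact : L -> 'rV[F]_coord_dim -> 'rV[F]_coord_dim;
  coord_ract : 'rV[F]_coord_dim -> L -> 'rV[F]_coord_dim;
  coord_lact_bilin : bilinear_for *:%R *:%R coord_lact;
  coord_ract_bilin : bilinear_for *:%R *:%R coord_ract;
  coord_bimodP : is_bimodule (@Biaction F L 'rV[F]_coord_dim
    (mk_bilinear coord_lact_bilin) (mk_bilinear coord_ract_bilin))
}.

Coercion bimod_of_coord (F : fieldType) (L : leibnizAlgebra F)
  (M : coord_bimod L) : bimodule L := Bimodule (coord_bimodP M).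

Lemma iso_coord_bimod (F : fieldType) (L : leibnizAlgebra F) (M : bimodule L) :
  exists N : coord_bimod L, bimod_iso M N.
Proof.
pose n := \dim {:M}; pose e := vbasis {:M}.
pose f (m : M) : 'rV[F]_n := \row_i coord e i m.
pose g (v : 'rV[F]_n) : M := \sum_i v 0 i *: e`_i.
have f_lin : linear f by move=> a u v; apply/rowP=> i; rewrite !mxE linearP.
have fK : cancel f g.
  move=> m; rewrite [RHS](coord_vbasis (memvf m)).
  by apply: eq_bigr => i _; rewrite mxE.
have gK : cancel g f.
  move=> v; apply/rowP=> i; rewrite mxE.
  by rewrite coord_sum_free ?(basis_free (vbasisP _)).
pose f' : {linear M -> 'rV[F]_n} :=
  HB.pack f (GRing.isLinear.Build F M 'rV[F]_n *:%R f f_lin).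
have g_lin : linear g by exact: (can2_linear (f := f') fK gK).
have l_bilin : bilinear_for *:%R *:%R (fun (x : L) v => f (x *> g v)).
  by split=> [v|x] a y z; rewrite -f_lin ?g_lin ?linearPl ?linearPr.
have r_bilin : bilinear_for *:%R *:%R (fun v (x : L) => f (g v <* x)).
  by split=> [x|v] a y z; rewrite -f_lin ?g_lin ?linearPl ?linearPr.
have fB u v : f u - f v = f (u - v).
  by rewrite addrC -scaleN1r -f_lin scaleN1r addrC.
have bimN : is_bimodule
    (@Biaction F L 'rV[F]_n (mk_bilinear l_bilin) (mk_bilinear r_bilin)).
  by split=> x y m /=; rewrite !fK fB ?(LLM (bimodP M)) ?(LML (bimodP M))
    ?(MLL (bimodP M)).
exists (CoordBimod bimN), f'.
by split=> [|x m|x m] /=; [exists g | rewrite fK | rewrite fK].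
Qed.

Section Grothendieck.
Variables (F : fieldType) (L : leibnizAlgebra F).

Record irrbi := IrrBi {
  irr_set :> set (coord_bimod L);
  irr_setP : exists2 M : coord_bimod L,
    irreducible M & irr_set = [set N : coord_bimod L | bimod_iso M N]
}.
HB.instance Definition _ := gen_eqMixin irrbi.
HB.instance Definition _ := gen_choiceMixin irrbi.

Lemma irrbi_inj : injective irr_set.
Proof.
case=> S SP [S' SP'] /= E; subst S'.
by rewrite (Prop_irrelevance SP SP').
Qed.

Definition irr_repr (C : irrbi) : bimodule L := projT1 (cid2 (irr_setP C)).

Lemma irr_repr_irreducible (C : irrbi) : irreducible (irr_repr C).
Proof. by rewrite /irr_repr; case: cid2. Qed.

Lemma irr_class_ex (M : bimodule L) : irreducible M ->
  exists C : irrbi, forall D : irrbi, bimod_iso M (irr_repr D) <-> D = C.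
Proof.
move=> irrM; have [N isoMN] := iso_coord_bimod M.
have irrN := irreducible_iso isoMN irrM.
exists (IrrBi (ex_intro2 _ _ N irrN erefl)) => D; split=> [isoMD|->].
  apply: irrbi_inj; move: isoMD.
  rewrite /irr_repr; case: cid2 => /= P irrP SE isoMP.
  have isoNP := bimod_iso_trans (bimod_iso_sym isoMN) isoMP.
  rewrite SE; apply/seteqP; split=> Q /=; first exact: bimod_iso_trans.
  by apply: bimod_iso_trans; exact: bimod_iso_sym.
rewrite /irr_repr; case: cid2 => /= P _ SE; apply: (bimod_iso_trans isoMN).
have : [set Q : coord_bimod L | bimod_iso P Q] N.
  by rewrite -SE; exact: bimod_iso_refl.
exact: bimod_iso_sym.
Qed.

Definition multiplicity (X M : bimodule L) : nat :=
  count (fun Y => `[< bimod_iso Y M >]) (comp_factors X).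

Definition grbi := {freeg irrbi}.

Definition gr_class (X : bimodule L) : grbi :=
  \sum_(C \in [set: irrbi]) << (multiplicity X (irr_repr C))%:Z *g C >>.

(* Biadditive extension of [M] * [N] = [trunc_tensor M N]. *)
Definition gr_mul (a b : grbi) : grbi :=
  fglift (fun C => fglift (fun D =>
    gr_class (trunc_tensor (irr_repr C) (irr_repr D))) b) a.

Lemma irr_repr_inj (C D : irrbi) :
  bimod_iso (irr_repr C) (irr_repr D) -> C = D.
Proof.
move=> isoCD; have [E EP] := irr_class_ex (irr_repr_irreducible C).
by rewrite (iffLR (EP C) (bimod_iso_refl _)) (iffLR (EP D) isoCD).
Qed.

Lemma multiplicity_supp (X : bimodule L) : exists r : seq irrbi,
  uniq r /\ forall C, C \notin r -> multiplicity X (irr_repr C) = 0%N.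
Proof.
rewrite /multiplicity; elim: (comp_factors X) => [|Y s [r [_ rP]]].
  by exists [::].
have [[D isoYD]|noD] := pselect (exists D, bimod_iso Y (irr_repr D)).
  exists (undup (D :: r)); split=> [|C]; first exact: undup_uniq.
  rewrite mem_undup inE => /norP[/eqP neqCD /rP sC] /=; rewrite sC addn0.
  rewrite asboolF // => isoYC; apply/neqCD/irr_repr_inj.
  exact: bimod_iso_trans (bimod_iso_sym isoYC) isoYD.
exists (undup r); split=> [|C]; first exact: undup_uniq.
rewrite mem_undup => /rP sC /=; rewrite sC addn0 asboolF // => isoYC.
by apply: noD; exists C.
Qed.

Lemma coeff_gr_class (X : bimodule L) (C : irrbi) :
  coeff C (gr_class X) = (multiplicity X (irr_repr C))%:Z.
Proof.
have [r [r_uniq rP]] := multiplicity_supp X.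
rewrite /gr_class (fsbigE r) //; last first.
  by move=> D _ /rP->; apply/eqP; rewrite freegU_eq0.
rewrite raddf_sum /= (eq_bigl xpredT); last by move=> D; rewrite in_setT.
have [Cr|/[dup] /rP-> Cr] := boolP (C \in r).
  rewrite (bigD1_seq C) //= coeffU eqxx mulr1 big1 ?addr0 // => D /negPf DC.
  by rewrite coeffU DC mulr0.
rewrite big_seq big1 // => D Dr; rewrite coeffU.
by case: eqP => [DC|]; [rewrite -DC Dr in Cr | rewrite mulr0].
Qed.

Lemma gr_mulU (C D : irrbi) : gr_mul << C >> << D >> =
  gr_class (trunc_tensor (irr_repr C) (irr_repr D)).
Proof. by rewrite /gr_mul !liftU !scale1r. Qed.

Lemma gr_mulDl (a b c : grbi) : gr_mul (a + b) c = gr_mul a c + gr_mul b c.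
Proof.
set f := fun C => fglift (fun D =>
  gr_class (trunc_tensor (irr_repr C) (irr_repr D))) c.
pose g : {additive grbi -> grbi} := HB.pack (fglift f)
  (GRing.isZmodMorphism.Build grbi grbi (fglift f) (lift_is_additive f)).
exact: (raddfD g).
Qed.

Lemma gr_mulDr (a b c : grbi) : gr_mul a (b + c) = gr_mul a b + gr_mul a c.
Proof.
pose f C D := gr_class (trunc_tensor (irr_repr C) (irr_repr D)).
have fD C : fglift (f C) (b + c) = fglift (f C) b + fglift (f C) c.
  pose g : {additive grbi -> grbi} := HB.pack (fglift (f C))
    (GRing.isZmodMorphism.Build grbi grbi _ (lift_is_additive (f C))).
  exact: (raddfD g).
rewrite /gr_mul; unlock fglift; rewrite /lift /prelift -big_split /=.
apply: eq_bigr => x _; rewrite -scalerDr; congr (_ *: _).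
by have := fD x.2; unlock fglift.
Qed.

End Grothendieck.

(* Main.v *)
(** Classes in the Grothendieck group are read off chosen composition series, so
    everything rests on the Jordan-Hoelder theorem: multiplicities do not depend
    on the series and are isomorphism invariants.  Commutativity then follows
    from the flip M (x) N -> N (x) M, which is equivariant and sends the
    generator of T(M, N) at (x, y, m, n) to the generator of T(N, M) at
    (x, y, n, m).  If M is the trivial bimodule, all generators of T(M, N)
    vanish and the truncated tensor product is N itself. *)

Require Import Defs.
From HB Require Import structures.
From mathcomp Require Import all_boot all_order all_algebra.
From mathcomp Require Import boolp classical_sets freeg.

Set Implicit Arguments.
Unset Strict Implicit.
Unset Printing Implicit Defensive.

Import GRing.Theory.
Local Open Scope ring_scope.

(** * Equivariant maps and stable subspaces *)

Definition equivariant (F : fieldType) (L : leibnizAlgebra F)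
    (M N : biaction L) (f : M -> N) : Prop :=
  (forall x m, f (x *> m) = x *> f m) /\ (forall x m, f (m <* x) = f m <* x).

Section Equivariant.
Variables (F : fieldType) (L : leibnizAlgebra F).

Lemma quot_proj_equivariant (M : biaction L) (U : stableSpace M) :
  equivariant (quot_proj U : M -> quot_biact U).
Proof. by split=> x m; [exact: quot_proj_lact | exact: quot_proj_ract]. Qed.

Lemma quot_proj_surj (M : biaction L) (U : stableSpace M) (q : quot_biact U) :
  exists m, quot_proj U m = q.
Proof. by exists (vsval q); exact: quot_projK. Qed.

(** Both [B] and [C] are the quotient of [A] by the common kernel of [p] and [q]. The source [A] is
    only a biaction, so that it can be an untruncated tensor product. *)
Lemma bimod_iso_ker (A : biaction L) (B C : bimodule L)
    (p : {linear A -> B}) (q : {linear A -> C}) :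
    equivariant p -> equivariant q ->
    (forall b, exists a, p a = b) -> (forall c, exists a, q a = c) ->
    (forall a, (p a == 0) = (q a == 0)) ->
  bimod_iso B C.
Proof.
move=> [pl pr] [ql qr] p_surj q_surj ker_pq.
pose s b := projT1 (cid (p_surj b)).
have sK b : p (s b) = b by rewrite /s; case: cid.
pose g b := q (s b).
(* The choice of the section [s] is harmless: two preimages under [p] differ by an element of its
   kernel, which [q] also kills. *)
have gp a : g (p a) = q a.
  by apply/eqP; rewrite -subr_eq0 -linearB -ker_pq linearB /= sK subrr eqxx.
have g_lin : linear g
  by move=> k b c; rewrite -{1}(sK b) -{1}(sK c) -linearP gp linearP.
pose g' : {linear B -> C} := HB.pack g
  (GRing.isLinear.Build F B C *:%R g g_lin).
exists g'; split=> [|x b|x b]; last 2 first.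
- by rewrite -{1}(sK b) -pl [LHS]gp ql.
- by rewrite -{1}(sK b) -pr [LHS]gp qr.
pose t c := projT1 (cid (q_surj c)).
have tK c : q (t c) = c by rewrite /t; case: cid.
exists (p \o t) => [b|c] /=; last by rewrite -[RHS]tK [LHS]gp.
apply/eqP; rewrite -{2}(sK b) -subr_eq0 -linearB ker_pq linearB /= tK.
by rewrite -/(g b) subrr.
Qed.

Lemma stable_space_inj (M : biaction L) :
  injective (@stable_space F L M).
Proof.
case=> U UP [V VP] /= E; case: _ / E in VP *.
by rewrite (Prop_irrelevance UP VP).
Qed.

Section Lattice.
Variable M : biaction L.

Fact stable_full_subproof (x : L) (m : M) :
  m \in fullv -> x *> m \in fullv /\ m <* x \in fullv.
Proof. by rewrite !memvf. Qed.
Definition stable_full : stableSpace M := StableSpace stable_full_subproof.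

Fact stable_add_subproof (U V : stableSpace M) (x : L) (m : M) :
  m \in (U + V)%VS -> x *> m \in (U + V)%VS /\ m <* x \in (U + V)%VS.
Proof.
case/memv_addP=> u /(stableP x)[xu ux] [v /(stableP x)[xv vx] ->].
by rewrite linearDr linearDl !memv_add.
Qed.
Definition stable_add (U V : stableSpace M) : stableSpace M :=
  StableSpace (@stable_add_subproof U V).

Fact stable_cap_subproof (U V : stableSpace M) (x : L) (m : M) :
  m \in (U :&: V)%VS -> x *> m \in (U :&: V)%VS /\ m <* x \in (U :&: V)%VS.
Proof.
by rewrite !memv_cap => /andP[/(stableP x)[-> ->] /(stableP x)[-> ->]].
Qed.
Definition stable_cap (U V : stableSpace M) : stableSpace M :=
  StableSpace (@stable_cap_subproof U V).

End Lattice.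

Section Image.
Variables (M N : biaction L) (f : {linear M -> N}).
Hypothesis f_equiv : equivariant f.

Fact stable_img_subproof (U : stableSpace M) (x : L) (n : N) :
  n \in (linfun f @: U)%VS ->
  x *> n \in (linfun f @: U)%VS /\ n <* x \in (linfun f @: U)%VS.
Proof.
case/memv_imgP=> m mU ->; rewrite lfunE /= -f_equiv.1 -f_equiv.2.
have [xm mx] := stableP x mU.
by split; apply/memv_imgP; [exists (x *> m) | exists (m <* x)];
  rewrite ?lfunE.
Qed.
Definition stable_img (U : stableSpace M) : stableSpace N :=
  StableSpace (@stable_img_subproof U).

Fact stable_preim_subproof (V : stableSpace N) (x : L) (m : M) :
  m \in (linfun f @^-1: V)%VS ->
  x *> m \in (linfun f @^-1: V)%VS /\ m <* x \in (linfun f @^-1: V)%VS.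
Proof.
by rewrite -!memv_preim !lfunE /= f_equiv.1 f_equiv.2 => /(stableP x).
Qed.
Definition stable_preim (V : stableSpace N) : stableSpace M :=
  StableSpace (@stable_preim_subproof V).

End Image.

End Equivariant.

(** * Isomorphism theorems for subquotients *)

Section Subquotients.
Variables (F : fieldType) (L : leibnizAlgebra F).

Definition subquot_proj (X : bimodule L) (W U : stableSpace X) :
  {linear sub_bimod U -> subquotient W U} := quot_proj (stable_in W U).

Lemma subquot_proj_eq0 (X : bimodule L) (W U : stableSpace X)
    (u : sub_bimod U) :
  (subquot_proj W U u == 0) = (vsval u \in (W : {vspace X})).
Proof. by rewrite [LHS]quot_proj_eq0 -memv_preim lfunE. Qed.

Lemma subquot_projP (X : bimodule L) (W U : stableSpace X)
    (u v : sub_bimod U) :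
  subquot_proj W U u = subquot_proj W U v <->
  vsval u - vsval v \in (W : {vspace X}).
Proof.
have := @quot_projP F L (sub_bimod U) (stable_in W U) u v.
by rewrite -memv_preim lfunE.
Qed.

(** Restricting [f] to [U] and projecting onto the subquotient of [U'] by [W'] gives a surjection,
    by the last hypothesis, with the same kernel as the projection of [U], by the one before it. Now
    [bimod_iso_ker] applies. *)
Lemma subquotient_iso (X Y : bimodule L) (f : {linear X -> Y})
    (W U : stableSpace X) (W' U' : stableSpace Y) :
    equivariant f ->
    (forall u, u \in (U : {vspace X}) -> f u \in (U' : {vspace Y})) ->
    (forall u, u \in (U : {vspace X}) ->
       (f u \in (W' : {vspace Y})) = (u \in (W : {vspace X}))) ->
    (forall v, v \in (U' : {vspace Y}) -> exists2 u,
       u \in (U : {vspace X}) & v - f u \in (W' : {vspace Y})) ->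
  bimod_iso (subquotient W U) (subquotient W' U').
Proof.
move=> [fl fr] fU fW f_surj.
pose res (u : sub_bimod U) : sub_bimod U' := Subvs (fU _ (subvsP u)).
have res_lin : linear res by move=> k u v; apply: val_inj; rewrite /= linearP.
pose res' : {linear sub_bimod U -> sub_bimod U'} := HB.pack res
  (GRing.isLinear.Build F (sub_bimod U) (sub_bimod U') *:%R res res_lin).
have [pl pr] := quot_proj_equivariant (stable_in W' U').
apply: (@bimod_iso_ker F L (sub_bimod U) _ _ (subquot_proj W U)
  (subquot_proj W' U' \o res')).
- exact: quot_proj_equivariant.
- split=> x m; rewrite -1?[RHS]pl -1?[RHS]pr; congr (quot_proj _ _);
    apply: val_inj; rewrite /= ?fl ?fr //.
- exact: quot_proj_surj.
- move=> c; have [v <-] := quot_proj_surj c.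
  have [u uU vu] := f_surj _ (subvsP v).
  by exists (Subvs uU); apply/esym/(subquot_projP W' v (res (Subvs uU))).
- move=> u; apply: etrans (subquot_proj_eq0 W u) _; apply/esym.
  by apply: etrans (subquot_proj_eq0 W' (res u)) _; rewrite /= fW ?subvsP.
Qed.

(** The image of [V] in the irreducible quotient is stable, hence zero or everything. Zero puts [V]
    inside [W]; everything means that each [u] in [U] agrees with some element of [V] modulo [W],
    and [W] lies in [V]. *)
Lemma irreducible_subquotient (X : bimodule L) (W U V : stableSpace X) :
  irreducible (subquotient W U) -> (W <= V)%VS -> (V <= U)%VS ->
  V = W \/ V = U.
Proof.
move=> [_ irr] WV VU.
have p_equiv : equivariant (subquot_proj W U) by exact: quot_proj_equivariant.
have inV u : vsval u \in (V : {vspace X}) ->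
    subquot_proj W U u \in (stable_img p_equiv (stable_in V U) : {vspace _}).
  by move=> uV; apply/memv_imgP; exists u; rewrite ?lfunE // -memv_preim lfunE.
case: (irr (stable_img p_equiv (stable_in V U))) => VE; [left|right].
  apply/stable_space_inj/eqP; rewrite eqEsubv WV andbT; apply/subvP => v vV.
  have := inV (vsproj U v); rewrite vsprojK ?(subvP VU) // => /(_ vV).
  by rewrite VE memv0 subquot_proj_eq0 vsprojK ?(subvP VU).
apply/stable_space_inj/eqP; rewrite eqEsubv VU; apply/subvP => u uU.
have : subquot_proj W U (vsproj U u) \in fullv by rewrite memvf.
rewrite -VE => /memv_imgP[v]; rewrite -memv_preim !lfunE => vV E.
have := iffLR (subquot_projP W _ _) E.
rewrite vsprojK // => /(subvP WV).
by move=> uvV; rewrite -(subrK (vsval v) u) rpredD.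
Qed.

(** Equal dimensions would make the quotient zero, which irreducibility excludes. *)
Lemma irreducible_subquotient_lt (X : bimodule L) (W U : stableSpace X) :
  (W <= U)%VS -> irreducible (subquotient W U) -> (\dim W < \dim U)%N.
Proof.
move=> WU [Q0 _]; rewrite ltnNge; apply: contra_neqN Q0 => UW.
have {UW} UW : (U <= W)%VS by rewrite -(geq_leqif (dimv_leqif_sup WU)).
apply/eqP; rewrite -subv0; apply/subvP => q _.
have [u <-] := quot_proj_surj q.
by rewrite memv0 [_ == 0]subquot_proj_eq0 (subvP UW) ?subvsP.
Qed.

End Subquotients.

(** * The Jordan-Hoelder theorem and invariance of classes *)

Section JordanHoelder.
Variables (F : fieldType) (L : leibnizAlgebra F).

(** This names the relation written inline in [composition_series], so path statements about either
    are convertible. *)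
Definition simple_step (X : bimodule L) (W U : stableSpace X) : bool :=
  (W <= U)%VS && `[< irreducible (subquotient W U) >].

Lemma simple_step_lt (X : bimodule L) (W U : stableSpace X) :
  simple_step W U -> (\dim W < \dim U)%N.
Proof. by case/andP=> WU /asboolP; exact: irreducible_subquotient_lt. Qed.

(** The identity of [X] induces the map: an element u + v of the sum is congruent to v modulo
    [U]. *)
Lemma second_isomorphism (X : bimodule L) (U V : stableSpace X) :
  bimod_iso (subquotient (stable_cap U V) V) (subquotient U (stable_add U V)).
Proof.
apply: (@subquotient_iso F L X X idfun) => [|v vV|v vV|w] /=.
- by split.
- by rewrite (subvP (addvSr U V)).
- by rewrite memv_cap vV andbT.
by case/memv_addP=> u uU [v vV ->]; exists v; rewrite ?addrK.
Qed.

(** The intersection lies between [W] and [U], so it is one of them. If it were [U], then [U] would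
    lie between [W] and [V], hence equal [W], against the strict growth of dimension, or [V]. *)
Lemma simple_step_cap (X : bimodule L) (W U V : stableSpace X) :
  simple_step W U -> simple_step W V -> U <> V -> stable_cap U V = W.
Proof.
move=> /[dup] WltU /andP[WU /asboolP irrU] /andP[WV /asboolP irrV] UV.
have WUV : (W <= stable_cap U V)%VS by rewrite subv_cap WU WV.
have [//|capU] := irreducible_subquotient irrU WUV (capvSl _ _).
have leUV : (U <= V)%VS by rewrite -capU capvSr.
have [UW|//] := irreducible_subquotient irrV WU leUV.
by move: (simple_step_lt WltU); rewrite UW ltnn.
Qed.

Lemma simple_step_diamond (X : bimodule L) (W U V : stableSpace X) :
    simple_step W U -> simple_step W V -> U <> V ->
  bimod_iso (subquotient W V) (subquotient U (stable_add U V)) /\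
  simple_step U (stable_add U V).
Proof.
move=> stU stV UV.
have iso : bimod_iso (subquotient W V) (subquotient U (stable_add U V)).
  by rewrite -{1}(simple_step_cap stU stV UV); exact: second_isomorphism.
split=> //; rewrite /simple_step addvSl /=; apply/asboolP.
by apply: irreducible_iso iso _; case/andP: stV => _ /asboolP.
Qed.

(** Unlike [ex_composition_series], this starts at an arbitrary [W]; it completes the diamond in
    [jordan_hoelder]. *)
Lemma ex_simple_path (X : bimodule L) (W : stableSpace X) :
  exists2 s, path (@simple_step X) W s & last W s = fullv :> {vspace X}.
Proof.
have [n] := ubnP (\dim {:X} - \dim W); elim: n W => // n IHn W leWn.
have [WT|/eqP WT] := eqVneq (W : {vspace X}) fullv; first by exists [::].
have [U [leWU ltWU irrWU]] := ex_irreducible_subquotient WT.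
have [|s pUs lUs] := IHn U.
  rewrite -ltnS; apply: leq_trans leWn; rewrite !ltnS ltn_sub2l //.
  by rewrite (leq_trans ltWU) ?dimvS ?subvf.
by exists (U :: s) => //=; rewrite pUs andbT /simple_step leWU; apply/asboolP.
Qed.

(** Induction on the codimension of [W]. If the first terms [U] and [V] differ, each series is
    compared with one passing through the sum of [U] and [V]. Counting an isomorphism-invariant
    predicate replaces a matching of the factors. *)
Lemma jordan_hoelder (P : pred (bimodule L)) (X : bimodule L)
    (W : stableSpace X) (s t : seq (stableSpace X)) :
    (forall Y Z, bimod_iso Y Z -> P Y = P Z) ->
    path (@simple_step X) W s -> last W s = fullv :> {vspace X} ->
    path (@simple_step X) W t -> last W t = fullv :> {vspace X} ->
  count P (pairmap (@subquotient F L X) W s) =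
  count P (pairmap (@subquotient F L X) W t).
Proof.
move=> P_iso.
(* Steps strictly raise the dimension, so none leaves the full space; this settles the cases where
   exactly one series is empty. *)
have no_step (V U : stableSpace X) r : V = fullv :> {vspace X} ->
    ~ path (@simple_step X) V (U :: r).
  by move=> VT /= /andP[/simple_step_lt]; rewrite VT ltnNge dimvS ?subvf.
have [n] := ubnP (\dim {:X} - \dim W).
elim: n W s t => // n IHn W [|U s] [|V t] leWn //.
- by move=> _ WT /(no_step _ _ _ WT).
- by move=> /no_step + _ _ WT => /(_ WT).
have IH (U' : stableSpace X) s' t' : simple_step W U' ->
    path (@simple_step X) U' s' -> last U' s' = fullv :> {vspace X} ->
    path (@simple_step X) U' t' -> last U' t' = fullv :> {vspace X} ->
    count P (pairmap (@subquotient F L X) U' s') =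
    count P (pairmap (@subquotient F L X) U' t').
  move=> WU'; apply: IHn; rewrite -ltnS; apply: leq_trans leWn.
  rewrite !ltnS ltn_sub2l ?simple_step_lt //.
  by rewrite (leq_trans (simple_step_lt WU')) ?dimvS ?subvf.
move=> /= /andP[stU pU] lU /andP[stV pV] lV.
have [UV|/[dup] UV /nesym VU] := pselect (U = V).
  by rewrite UV in pU lU *; congr addn; exact: IH lV.
have [isoV addU] := simple_step_diamond stU stV UV.
have [isoU addV] := simple_step_diamond stV stU VU.
have addC : stable_add V U = stable_add U V.
  by apply: stable_space_inj; exact: addvC.
rewrite addC in isoU addV.
(* The tail [r] is shared by both comparison series, so only the two bottom factors on each side
   matter, and the diamond exchanges them. *)
have [r pr lr] := ex_simple_path (stable_add U V).
rewrite (IH U s (stable_add U V :: r)) //= ?addU //.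
rewrite (IH V t (stable_add U V :: r)) //= ?addV //.
by rewrite (P_iso _ _ isoU) (P_iso _ _ isoV) addnCA.
Qed.

Lemma bimod_iso_asbool (Y Z M : bimodule L) :
  bimod_iso Y Z -> `[< bimod_iso Y M >] = `[< bimod_iso Z M >].
Proof.
move=> YZ; apply: asbool_equiv_eq; split; apply: bimod_iso_trans => //.
exact: bimod_iso_sym.
Qed.

Lemma multiplicityE (X M : bimodule L) (s : seq (stableSpace X)) :
  composition_series s ->
  multiplicity X M = count (fun Y => `[< bimod_iso Y M >])
    (pairmap (@subquotient F L X) (stable0 X) s).
Proof.
case=> ps ls; rewrite /multiplicity /comp_factors /the_comp_series.
case: cid => t /= [pt lt]; apply: jordan_hoelder => // Y Z.
exact: bimod_iso_asbool.
Qed.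

(** The image under [f] of a composition series of [X] is one of [Y], with isomorphic factors; by
    [multiplicityE] it may be used for counting. *)
Lemma multiplicity_iso (X Y M : bimodule L) :
  bimod_iso X Y -> multiplicity X M = multiplicity Y M.
Proof.
move=> isoXY; have [f [[g fK gK] fl fr]] := isoXY.
have f_equiv : equivariant f by [].
pose fS := stable_img f_equiv.
have memf (U : stableSpace X) u :
    (f u \in (fS U : {vspace Y})) = (u \in (U : {vspace X})).
  apply/memv_imgP/idP => [[v vU]|uU]; last by exists u; rewrite ?lfunE.
  by rewrite lfunE => /(can_inj fK)->.
have iso (W U : stableSpace X) :
    bimod_iso (subquotient W U) (subquotient (fS W) (fS U)).
  apply: (subquotient_iso f_equiv) => [u|u|v]; rewrite ?memf //.
  by case/memv_imgP=> u uU ->; exists u; rewrite // lfunE subrr mem0v.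
have f0 : fS (stable0 X) = stable0 Y by apply: stable_space_inj; exact: limg0.
have [s sP] := ex_composition_series X; have [ps ls] := sP.
rewrite (multiplicityE M sP) (multiplicityE M (s := map fS s)).
  rewrite -f0; elim: s (stable0 X) {sP ps ls f0} => //= U s IHs W.
  by rewrite IHs (bimod_iso_asbool _ (iso W U)).
split; rewrite -f0; last first.
  rewrite last_map; apply/vspaceP => y; rewrite memvf -[y]gK memf.
  by rewrite ls memvf.
rewrite path_map; apply: sub_path ps => W U /andP[WU /asboolP irrWU] /=.
by rewrite limgS //=; apply/asboolP/(irreducible_iso (iso W U)).
Qed.

Lemma gr_class_iso (X Y : bimodule L) :
  bimod_iso X Y -> gr_class X = gr_class Y.
Proof.
move=> isoXY; apply/eqP/freeg_eqP => C.
by rewrite !coeff_gr_class (multiplicity_iso _ isoXY).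
Qed.

Lemma gr_class_irr (C : irrbi L) : gr_class (irr_repr C) = << C >>.
Proof.
set X := irr_repr C; have irrX : irreducible X := irr_repr_irreducible C.
(* The single factor of the series from zero to [X] is only isomorphic to [X]: it is carried by a
   complement inside a subspace type. *)
have isoX : bimod_iso X (subquotient (stable0 X) (stable_full X)).
  have idX : (forall u : X, u \in fullv) by move=> u; exact: memvf.
  pose T := stable_full X.
  pose i : X -> sub_bimod T := fun u => Subvs (idX u).
  have i_lin : linear i by move=> k u v; exact: val_inj.
  pose i' : {linear X -> sub_bimod T} := HB.pack i
    (GRing.isLinear.Build F X (sub_bimod T) *:%R i i_lin).
  have [pl pr] := quot_proj_equivariant (stable_in (stable0 X) T).
  apply: (@bimod_iso_ker F L X _ _ idfun
    (subquot_proj (stable0 X) T \o i')).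
  - by split.
  - split=> x m; rewrite -1?[RHS]pl -1?[RHS]pr; congr (quot_proj _ _);
      exact: val_inj.
  - by move=> b; exists b.
  - move=> c; have [u <-] := quot_proj_surj c.
    by exists (vsval u); congr (quot_proj _ _); exact: val_inj.
  by move=> a; rewrite [RHS]subquot_proj_eq0 memv0.
have sP : composition_series [:: stable_full X].
  split=> //=; rewrite andbT subvf /=; apply/asboolP.
  exact: irreducible_iso isoX irrX.
apply/eqP/freeg_eqP => D; rewrite coeff_gr_class (multiplicityE _ sP) /= addn0.
rewrite -(bimod_iso_asbool _ isoX) coeffU mul1r.
suff -> : `[< bimod_iso X (irr_repr D) >] = (C == D) by case: (C == D).
by apply/asboolP/eqP => [/irr_repr_inj //|<-]; exact: bimod_iso_refl.
Qed.

End JordanHoelder.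

(** * Flip and unit for the truncated tensor product *)

Section TruncatedTensor.
Variables (F : fieldType) (L : leibnizAlgebra F).

Lemma tr_tens (M N : vectType F) (m : M) (n : N) :
  (tens m n)^T = tens n m :> tens_space N M.
Proof. by apply/matrixP=> i j; rewrite !mxE mulrC. Qed.

(** In the matrix model of the tensor product, the flip is transposition ([tr_tens]). *)
Definition tens_swap (M N : biaction L) :
  {linear tens_biact M N -> tens_biact N M} := trmx.

(** Pure tensors span, so equivariance is tested on them; the left-hand sides are [f] applied to the
    Leibniz expansion of the action. *)
Lemma tens_equivariant (M N K : biaction L) (f : {linear tens_biact M N -> K}) :
    (forall x m n, f (tens (x *> m) n) + f (tens m (x *> n)) =
       x *> f (tens m n)) ->
    (forall x m n, f (tens (m <* x) n) + f (tens m (n <* x)) =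
       f (tens m n) <* x) ->
  equivariant f.
Proof.
move=> fl fr; split=> x.
  apply: (tens_ext (f := f \o lact (tens_biact M N) x)
    (g := lact K x \o f)) => m n /=.
  by rewrite tens_lactE -fl; exact: linearD.
apply: (tens_ext (f := f \o applyr (ract (tens_biact M N)) x)
  (g := applyr (ract K) x \o f)) => m n /=.
by rewrite /applyr /= tens_ractE -fr; exact: linearD.
Qed.

Lemma tens_swap_equivariant (M N : biaction L) :
  equivariant (tens_swap M N).
Proof.
apply: tens_equivariant => x m n; rewrite /= !tr_tens.
  by rewrite tens_lactE addrC.
by rewrite tens_ractE addrC.
Qed.

(** The preimage of T(N, M) under the flip is stable and contains the generators of T(M, N), so
    minimality of T(M, N) applies. *)
Lemma tens_swap_truncation (M N : biaction L) (t : tens_biact M N) :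
  t \in (truncation M N : {vspace _}) ->
  tens_swap M N t \in (truncation N M : {vspace _}).
Proof.
have [_ minT] := truncationP M N; have [genT _] := truncationP N M.
pose V := stable_preim (@tens_swap_equivariant M N) (truncation N M).
suff genV s : trunc_gens s -> s \in (V : {vspace _}).
  by move/(subvP (minT V genV)); rewrite -memv_preim lfunE.
case=> x [y [m [n ->]]]; rewrite -memv_preim lfunE; apply: genT.
by exists x, y, n, m; rewrite /= linearD /= !tr_tens addrC.
Qed.

Lemma trunc_tensorC (M N : bimodule L) :
  bimod_iso (trunc_tensor M N) (trunc_tensor N M).
Proof.
pose p : {linear tens_biact M N -> trunc_tensor M N} :=
  quot_proj (truncation M N).
pose q : {linear tens_biact N M -> trunc_tensor N M} :=
  quot_proj (truncation N M).
have [ql qr] : equivariant q by exact: quot_proj_equivariant.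
have [sl sr] := @tens_swap_equivariant M N.
apply: (@bimod_iso_ker F L _ _ _ p (q \o tens_swap M N)).
- exact: quot_proj_equivariant.
- by split=> x t; rewrite [LHS]/= -[tens_swap M N _]/(tens_swap M N _)
    ?sl ?sr ?ql ?qr.
- exact: quot_proj_surj.
- move=> c; have [t <-] := quot_proj_surj c.
  by exists (tens_swap N M t); rewrite /= trmxK.
move=> t; rewrite [LHS]quot_proj_eq0 [RHS]quot_proj_eq0.
(* The converse inclusion uses the same lemma on the flipped tensor, the flip being an
   involution. *)
by apply/idP/idP => /tens_swap_truncation; rewrite // /= trmxK.
Qed.

(** Any [M] isomorphic to the trivial bimodule is allowed because [gr_mul] multiplies chosen
    representatives. The map sending m (x) n to f(m) n is compared with the projection: it kills
    T(M, N), and it is injective. *)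
Lemma trunc_tensor1l (M N : bimodule L) :
  bimod_iso (triv_bimod L) M -> bimod_iso (trunc_tensor M N) N.
Proof.
case/bimod_iso_sym=> f [[g fK gK] fl fr].
have lM0 (x : L) (m : M) : x *> m = 0.
  by apply: (can_inj fK); rewrite fl linear0.
have rM0 (x : L) (m : M) : m <* x = 0.
  by apply: (can_inj fK); rewrite fr linear0.
(* The vector of [M] matching 1 in the ground field; it spans [M], and tensoring with it inverts
   [q]. *)
pose e := g 1.
have fe m : f m *: e = m.
  by apply: (can_inj fK); rewrite linearZ gK; exact: mulr1.
pose h (m : M) (n : N) : N := (f m : F) *: n.
have h_bilin : bilinear_for *:%R *:%R h.
  split=> [n|m] a u v; rewrite /h.
    by rewrite linearP scalerDl -scalerA.
  by rewrite scalerDr scalerA mulrC -scalerA.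
pose q : {linear tens_biact M N -> N} := tens_lift h.
have qE m n : q (tens m n) = (f m : F) *: n by exact: tens_lift_tens.
have q_equiv : equivariant q.
  apply: tens_equivariant => x m n; rewrite !qE.
    by rewrite lM0 linear0 scale0r add0r linearZr.
  by rewrite rM0 linear0 scale0r add0r linearZl.
have qK t : tens e (q t) = t.
  pose b : {bilinear M -> N -> tens_space M N} := @tens F M N.
  pose r : {linear tens_space M N -> tens_space M N} := b e \o q.
  apply: (tens_ext (f := r) (g := idfun)) => m n /=.
  by rewrite [tens_lift _ _]qE linearZr -linearZl fe.
have [_ minT] := truncationP M N.
have q_trunc t : t \in (truncation M N : {vspace _}) -> q t = 0.
  pose V := stable_preim q_equiv (stable0 N).
  suff genV s : trunc_gens s -> s \in (V : {vspace _}).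
    by move/(subvP (minT V genV)); rewrite -memv_preim lfunE memv0 => /eqP.
  case=> x [y [m [n ->]]].
  (* Both summands of a generator have a left factor built from actions on [M], which are zero. *)
  by rewrite lM0 !rM0 addr0 !linear0l addr0 mem0v.
pose p : {linear tens_biact M N -> trunc_tensor M N} :=
  quot_proj (truncation M N).
apply: (@bimod_iso_ker F L _ _ _ p q) => //.
- exact: quot_proj_equivariant.
- exact: quot_proj_surj.
- by move=> n; exists (tens e n); rewrite qE gK scale1r.
move=> t; rewrite [LHS]quot_proj_eq0; apply/idP/eqP => [/q_trunc //|qt0].
by rewrite -(qK t) qt0 linear0r mem0v.
Qed.

End TruncatedTensor.

(** * Ring identities in the Grothendieck group *)

Section GrothendieckRing.
Variables (F : fieldType) (L : leibnizAlgebra F).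
Local Notation gr := (grbi L).

Lemma vspace_regular (K : fieldType) (U : {vspace K^o}) :
  U = 0%VS \/ U = fullv.
Proof.
have [->|U0] := eqVneq U 0%VS; [by left | right].
apply/eqP; rewrite eqEdim subvf dimvf /dim /=.
by rewrite lt0n dimv_eq0.
Qed.

Lemma triv_irreducible : irreducible (triv_bimod L).
Proof.
split; last by move=> U; exact: (@vspace_regular F U).
by rewrite -dimv_eq0 dimvf.
Qed.

Lemma gr_mul0l (b : gr) : gr_mul 0 b = 0.
Proof. by apply: (addrI (gr_mul 0 b)); rewrite -gr_mulDl !addr0. Qed.

Lemma gr_mul0r (a : gr) : gr_mul a 0 = 0.
Proof. by apply: (addrI (gr_mul a 0)); rewrite -gr_mulDr !addr0. Qed.

Lemma gr_mulZU (k l : int) (C D : irrbi L) :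
  gr_mul << k *g C >> << l *g D >> =
    (k * l) *: gr_class (trunc_tensor (irr_repr C) (irr_repr D)).
Proof. by rewrite /gr_mul !liftU scalerA. Qed.

(** Biadditivity reduces the claim, by induction on each argument, to multiples of basis elements,
    where the flip isomorphism gives equal classes. *)
Lemma gr_mulC : commutative (@gr_mul F L).
Proof.
move=> a b; elim/freeg_ind_dom0: a => [|k C a _ _ IHa].
  by rewrite gr_mul0l gr_mul0r.
rewrite gr_mulDl gr_mulDr IHa; congr (_ + _) => {a IHa}.
elim/freeg_ind_dom0: b => [|l D b _ _ IHb].
  by rewrite gr_mul0l gr_mul0r.
rewrite gr_mulDl gr_mulDr IHb; congr (_ + _).
by rewrite !gr_mulZU mulrC (gr_class_iso (trunc_tensorC _ _)).
Qed.

(** The trivial bimodule is irreducible, so its class is a basis element [C], and the product with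
    any basis element is read off from [trunc_tensor1l]. *)
Lemma gr_mul1l : left_id (gr_class (triv_bimod L)) (@gr_mul F L).
Proof.
have [C CP] := irr_class_ex triv_irreducible.
have isoC : bimod_iso (triv_bimod L) (irr_repr C) by apply/CP.
rewrite (gr_class_iso isoC) gr_class_irr.
elim/freeg_ind_dom0 => [|k D b _ _ IHb]; first exact: gr_mul0r.
rewrite gr_mulDr IHb; congr (_ + _).
rewrite gr_mulZU (gr_class_iso (trunc_tensor1l _ isoC)) gr_class_irr.
by apply/eqP/freeg_eqP => E; rewrite coeffZ !coeffU !mul1r.
Qed.

End GrothendieckRing.

Theorem proposition5p1 (F : fieldType) (L : leibnizAlgebra F) :
  commutative (@gr_mul F L) /\
  left_id (gr_class (triv_bimod L)) (@gr_mul F L) /\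
  right_id (gr_class (triv_bimod L)) (@gr_mul F L).
Proof.
split; first exact: gr_mulC.
by split=> [|a]; [exact: gr_mul1l | rewrite gr_mulC gr_mul1l].
Qed.
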